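(* Let $\Gamma_J(x,y)=(x,y,2xy)$ for $(x,y)\in\mathbb R^2$. For $S\subseteq\mathbb R^2$, the closed lifted scalar hull $$\{(x,y)\in\mathbb R^2:\Gamma_J(x,y)\in\overline{\operatorname{co}}(\Gamma_J(S))\}$$ is the intersection of all regions of the form $$\{(x,y)\in\mathbb R^2:\ a+bx+cy+2dxy\ge0\},\qquad a,b,c,d\in\mathbb R,$$ containing $S$. If $\operatorname{co}(\Gamma_J(S))$ is closed (in particular, if $S$ is compact), this is the scalar $\Gamma_J$-convex hull of $S$ itself.
   Context: $\operatorname{co}$ and $\overline{\operatorname{co}}$ denote the ordinary convex hull and closed convex hull in $\mathbb R^3$. $\Gamma_J$ is the level-one restriction of the free graph map $(x,y)\mapsto(x,y,xy+yx)$. The scalar $\Gamma_J$-convex hull of $S$ (generated using scalar points of $S$) is $\{(x,y):(x,y,2xy)\in\operatorname{co}(\Gamma_J(S))\}$. *)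

(* Defs.v *)
From mathcomp Require Import all_boot all_order all_algebra.
From mathcomp Require Import all_classical all_reals all_analysis.

Set Implicit Arguments.
Unset Strict Implicit.
Unset Printing Implicit Defensive.

Import Order.TTheory GRing.Theory Num.Theory.
Import numFieldNormedType.Exports.

Local Open Scope classical_set_scope.
Local Open Scope ring_scope.

Definition conv_hull (R : realType) (V : lmodType R) (A : set V) : set V :=
  smallest (@convex_set R V) A.

Definition closed_conv_hull (R : realType) (V : normedModType R) (A : set V) :
  set V := closure (conv_hull A).

(* Here [R * R] and [R * R * R] are the plane and 3-space, with the library's
   normed module structure on products (sup norm, hence the usual topology). *)

Definition Gamma_J (R : realType) (p : R * R) : R * R * R :=
  (p.1, p.2, 2 * p.1 * p.2).

Definition scalar_hull (R : realType) (S : set (R * R)) : set (R * R) :=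
  [set p | conv_hull (@Gamma_J R @` S) (Gamma_J p)].

Definition closed_scalar_hull (R : realType) (S : set (R * R)) : set (R * R) :=
  [set p | closed_conv_hull (@Gamma_J R @` S) (Gamma_J p)].

Definition region (R : realType) (a b c d : R) : set (R * R) :=
  [set p | 0 <= a + b * p.1 + c * p.2 + 2 * d * p.1 * p.2].

(* Main.v *)
Require Import Defs.
From mathcomp Require Import all_boot all_order all_algebra.
From mathcomp Require Import all_classical all_reals all_analysis.
From mathcomp Require Import lra ring.
Set Implicit Arguments.
Unset Strict Implicit.
Unset Printing Implicit Defensive.

Import Order.TTheory GRing.Theory Num.Theory.
Import numFieldNormedType.Exports.
Local Open Scope classical_set_scope.
Local Open Scope ring_scope.

(** A region [0 <= a + b x + c y + 2 d x y] is the preimage under [Gamma_J] of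
    the closed half-space [0 <= a + b u + c v + d w] of 3-space: the lift turns
    the bilinear term into a third coordinate ([region_Gamma_J]).  So the
    regions containing [S] correspond to the closed half-spaces containing the
    lifted set (the whole space and the empty set being degenerate cases), and
    the description of the closed lifted hull is the pullback of the classical
    fact that a closed convex set is the intersection of the closed half-spaces
    around it.  One inclusion holds because half-spaces are closed and convex.
    The other is strict separation of a point from a closed convex set
    ([separation]); in 3-space this follows from the existence of a nearest
    point, obtained by compactness of boxes.

    When the convex hull of the lift is already closed, taking its closure
    changes nothing.  For compact [S] the lift is compact by continuity, and it
    remains to see that the convex hull of a compact set of 3-space is closed.
    Caratheodory's theorem ([caratheodory]) bounds the number of points needed
    in a convex combination, so the hull is reached by joining the set with
    itself finitely many times; each join is a continuous image of a product of
    compact sets ([iter_join_compact]), and a compact set is closed. *)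

(** * Convex sets and their closures *)

(** Trades the bundled interval coefficient for an explicit scalar, which is
    what the computations below produce. *)
Lemma convex_setP (R : realType) (V : lmodType R) (A : set V) :
  @convex_set R V A <->
  forall (t : R) x y, 0 <= t -> t <= 1 -> A x -> A y ->
    A (t *: x + (1 - t) *: y).
Proof.
split=> [cA t x y t0 t1 Ax Ay|cA x y t /[!inE] Ax Ay].
  by have := cA x y (Itv01 t0 t1); rewrite !inE; exact.
exact: cA.
Qed.

Lemma sub_conv_hull (R : realType) (V : lmodType R) (A : set V) :
  A `<=` conv_hull A.
Proof. exact: sub_smallest. Qed.

Lemma conv_hull_convex (R : realType) (V : lmodType R) (A : set V) :
  @convex_set R V (conv_hull A).
Proof.
apply/convex_setP => t x y t0 t1 Ax Ay B [cB AB].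
by move/convex_setP : (cB); apply => //; [exact: Ax|exact: Ay].
Qed.

(** The two arguments are moved to the closure one at a time: with one of them
    fixed, the combination is continuous in the other, so the points that it
    sends into [closure A] form a closed set, which contains [closure A] as
    soon as it contains [A]. *)
Lemma closure_convex (R : realType) (V : normedModType R) (A : set V) :
  @convex_set R V A -> @convex_set R V (closure A).
Proof.
move=> /convex_setP cA; apply/convex_setP => t x y t0 t1.
have cl : closed (closure A) by exact: closed_closure.
have step (f : V -> V) : continuous f -> A `<=` f @^-1` closure A ->
    closure A `<=` f @^-1` closure A.
  move=> cf Af; rewrite {1}closureE; apply: smallest_sub => //.
  by apply: preimage_closed => // ? _; exact: cf.
move=> Ax Ay; move: x Ax; apply: (step (fun x => t *: x + (1 - t) *: y)).
  move=> x; apply: cvgD; last exact: cvg_cst.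
  exact: scaler_continuous.
move=> x Ax /=; move: y Ay; apply: (step (fun y => t *: x + (1 - t) *: y)).
  move=> y; apply: cvgD; first exact: cvg_cst.
  exact: scaler_continuous.
by move=> y Ay; apply: subset_closure; exact: cA.
Qed.

(** * Half-spaces of 3-space *)

(** The norm on products is the sup norm, which has no unique nearest points and
    no orthogonality; separation needs the Euclidean inner product. *)
Definition dot (R : realType) (u v : R * R * R) : R :=
  u.1.1 * v.1.1 + u.1.2 * v.1.2 + u.2 * v.2.

Lemma dot_ge0 (R : realType) (v : R * R * R) : 0 <= dot v v.
Proof. by rewrite /dot -!expr2 !addr_ge0 ?sqr_ge0. Qed.

Lemma dot_eq0 (R : realType) (v : R * R * R) : dot v v = 0 -> v = 0.
Proof.
case: v => [[x y] z]; rewrite /dot /= -!expr2 => /eqP.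
rewrite !paddr_eq0 ?addr_ge0 ?sqr_ge0 // !sqrf_eq0.
by move=> /andP[/andP[/eqP-> /eqP->] /eqP->].
Qed.

Lemma cvg_dot (R : realType) (T : Type) (F : set_system T) (FF : Filter F)
    (f g : T -> R * R * R) (u v : R * R * R) :
  f x @[x --> F] --> u -> g x @[x --> F] --> v ->
  dot (f x) (g x) @[x --> F] --> dot u v.
Proof.
have cvg1 (U W : topologicalType) (h : T -> U * W) (w : U * W) :
    h x @[x --> F] --> w -> (h x).1 @[x --> F] --> w.1.
  by move=> hw; apply: (@cvg_comp _ _ _ h fst _ (nbhs w)) => //; exact: cvg_fst.
have cvg2 (U W : topologicalType) (h : T -> U * W) (w : U * W) :
    h x @[x --> F] --> w -> (h x).2 @[x --> F] --> w.2.
  by move=> hw; apply: (@cvg_comp _ _ _ h snd _ (nbhs w)) => //; exact: cvg_snd.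
move=> fu gv; apply: cvgD; [apply: cvgD|]; apply: cvgM;
  by [exact/cvg1/cvg1|exact/cvg2/cvg1|exact/cvg2].
Qed.

Lemma dot_continuous (R : realType) (u : R * R * R) : continuous (dot u).
Proof. by move=> v; apply: cvg_dot; [exact: cvg_cst|exact: cvg_id]. Qed.

Lemma halfspace_convex (R : realType) (a : R) (v : R * R * R) :
  @convex_set R (R * R * R)%type [set z | 0 <= a + dot v z].
Proof.
apply/convex_setP => t x y t0 t1 /=; rewrite /dot /= => hx hy.
rewrite /GRing.scale /=.
have t1' : 0 <= 1 - t by lra.
have := addr_ge0 (mulr_ge0 t0 hx) (mulr_ge0 t1' hy).
by congr (0 <= _); ring.
Qed.

Lemma halfspace_closed (R : realType) (a : R) (v : R * R * R) :
  closed [set z | 0 <= a + dot v z].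
Proof.
apply: (@preimage_closed _ _ (fun z => a + dot v z) [set r | 0 <= r]).
  by move=> z _; apply: cvgD; [exact: cvg_cst|exact: dot_continuous].
exact: closed_ge.
Qed.

(** * Separation of a point from a closed convex set *)

(** Only the points of [C] at least as close to [p] as a given [z0] compete for
    the minimum, and these lie in a box around [p]; the box is compact, so the
    continuous squared distance attains its minimum there. *)
Lemma nearest_point (R : realType) (C : set (R * R * R)) (p : R * R * R) :
  closed C -> C !=set0 ->
  exists2 q, C q & forall z, C z -> dot (q - p) (q - p) <= dot (z - p) (z - p).
Proof.
move=> clC [z0 Cz0]; pose f z := dot (z - p) (z - p).
(* x ^+ 2 <= D forces |x| <= 1 + D, which avoids a square root. *)
pose r := 1 + f z0.
pose B := ((`[p.1.1 - r, p.1.1 + r] `*` `[p.1.2 - r, p.1.2 + r]) `*`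
  `[p.2 - r, p.2 + r])%classic.
have f0 z : 0 <= f z by exact: dot_ge0.
have BP z : f z <= f z0 -> B z.
  have coord (a b : R) : (a - b) ^+ 2 <= f z -> f z <= f z0 ->
      b - r <= a <= b + r.
    move=> ab fz; have abD := le_trans ab fz; have := f0 z0.
    rewrite /r; move: (f z0) abD => D abD D0.
    by apply/andP; split; nra.
  move=> fz; rewrite /B /= !in_itv /=.
  have sq (x y t : R) : [/\ x ^+ 2 <= x ^+ 2 + y ^+ 2 + t ^+ 2,
      y ^+ 2 <= x ^+ 2 + y ^+ 2 + t ^+ 2 & t ^+ 2 <= x ^+ 2 + y ^+ 2 + t ^+ 2].
    by have := (sqr_ge0 x, sqr_ge0 y, sqr_ge0 t) => -[[? ?] ?]; split; lra.
  have [? ? ?] := sq (z.1.1 - p.1.1) (z.1.2 - p.1.2) (z.2 - p.2).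
  by split; [split|]; apply: coord.
have cB : compact B.
  by do 2?apply: compact_setX; exact: segment_compact.
have cf : continuous f.
  by move=> z; apply: cvg_dot; apply: cvgB;
    do ?[exact: cvg_id|exact: cvg_cst].
have cCB : compact (C `&` B).
  apply: (subclosed_compact _ cB) => //; apply: closedI => //.
  by apply: compact_closed => //; exact: norm_hausdorff.
have CB0 : (C `&` B) !=set0 by exists z0; split=> //; exact: BP.
have [q /[!inE] -[Cq Bq] qmin] :=
  compact_EVT_min CB0 cCB (continuous_subspaceT cf).
exists q => // z Cz; have [/BP Bz|/ltW fz] := leP (f z) (f z0).
  by apply: qmin; rewrite inE.
by apply: le_trans fz; apply: qmin; rewrite inE; split=> //; exact: BP.
Qed.

(** The separating plane passes through the point [q] of [C] nearest to [p],
    orthogonally to [q - p].  If some [z] in [C] were strictly on the side of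
    [p], a small step from [q] towards [z] would stay in [C] and come closer
    to [p]. *)
Lemma separation (R : realType) (C : set (R * R * R)) (p : R * R * R) :
  @convex_set R (R * R * R)%type C -> closed C -> ~ C p ->
  exists a (v : R * R * R),
    C `<=` [set z | 0 <= a + dot v z] /\ a + dot v p < 0.
Proof.
move=> /convex_setP cC clC nCp.
have [C0|/set0P C0] := eqVneq C set0.
  exists (-1), 0; split; first by rewrite C0.
  by rewrite /dot /=; lra.
have [q Cq qmin] := nearest_point p clC C0.
pose v := q - p; exists (- dot v q), v; split=> [z Cz/=|].
  rewrite leNgt; apply/negP => neg.
  pose A := dot (z - q) (z - q); pose e := - (- dot v q + dot v z).
  have A0 : 0 <= A by exact: dot_ge0.
  have e0 : 0 < e by rewrite /e oppr_gt0.
  (* The step t changes the squared distance to p by - t * (2 * e - t * A);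
     this value of t makes t * A < e and keeps t within [0, 1]. *)
  pose t := e / (A + e).
  have t0 : 0 < t by rewrite divr_gt0 // ltr_wpDl.
  have t1 : t <= 1 by rewrite ler_pdivrMr ?mul1r ?lerDr// ltr_wpDl.
  have := qmin _ (cC t z q (ltW t0) t1 Cz Cq).
  have -> : dot (t *: z + (1 - t) *: q - p) (t *: z + (1 - t) *: q - p)
      = dot (q - p) (q - p) - t * (2 * e - t * A).
    by rewrite /e /A /v /dot /= /GRing.scale /=; ring.
  suff : 0 < t * (2 * e - t * A) by lra.
  rewrite mulr_gt0 //.
  have tAe : t * (A + e) = e by rewrite /t divfK // gt_eqF // ltr_wpDl.
  have : 0 < t * e by rewrite mulr_gt0.
  lra.
have : 0 < dot v v.
  rewrite lt_neqAle dot_ge0 andbT; apply/eqP => /esym/dot_eq0/eqP.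
  by rewrite subr_eq0 => /eqP qp; apply: nCp; rewrite -qp.
by rewrite /v /dot /=; lra.
Qed.

(** * Caratheodory's theorem *)

(** Combinations are indexed by an arbitrary finite type and only the number of
    nonzero weights is bounded: points can then be dropped by annihilating
    their weight, without reindexing. *)
Definition convex_combs (R : realType) (V : lmodType R) (A : set V) (n : nat) :
    set V :=
  [set p | exists (I : finType) (w : I -> R) (x : I -> V),
    [/\ forall i, 0 <= w i, forall i, A (x i), \sum_i w i = 1,
        (#|support w| <= n)%N & p = \sum_i w i *: x i]].

(** The convex combinations of unbounded length form a convex set: two index
    types are merged into their disjoint sum. *)
Lemma conv_hull_sub_convex_combs (R : realType) (V : lmodType R) (A : set V) p :
  conv_hull A p -> exists n, convex_combs A n p.
Proof.
move: p; apply: smallest_sub; last first.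
  move=> a Aa; exists 1%N, unit, (fun=> 1), (fun=> a); split=> //.
  - by rewrite big_const card_unit /= addr0.
  - by rewrite (leq_trans (max_card _)) // card_unit.
  - by rewrite big_const card_unit /= addr0 scale1r.
apply/convex_setP => t p q t0 t1.
have t1' : 0 <= 1 - t by rewrite subr_ge0.
move=> [m [I [w [x [w0 Ax w1 _ ->]]]]] [n [J [w' [x' [w'0 Ax' w'1 _ ->]]]]].
exists #|{: I + J}|, (I + J)%type.
exists (fun k => match k with inl i => t * w i | inr j => (1 - t) * w' j end).
exists (fun k => match k with inl i => x i | inr j => x' j end).
split=> [[i|j]|[i|j]| | |] //; rewrite ?mulr_ge0 //.
- by rewrite big_sumType /= -!mulr_sumr w1 w'1; ring.
- exact: max_card.
- by rewrite big_sumType /= !scaler_sumr; congr (_ + _);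
    apply: eq_bigr => i _; rewrite scalerA.
Qed.

(** An affine dependence between points is a linear dependence between the
    points lifted to height 1, and these live in one dimension more. *)
Lemma affine_dependence (K : fieldType) (V : vectType K) (I : finType)
    (x : I -> V) (D : {pred I}) :
  ((\dim {:V}).+1 < #|D|)%N ->
  exists l : I -> K, [/\ forall i, i \notin D -> l i = 0, exists i, l i != 0,
    \sum_i l i = 0 & \sum_i l i *: x i = 0].
Proof.
move=> dD; pose y i : V * K^o := (x i, 1).
pose X := [tuple y (enum_val j) | j < #|D|].
have /freeP : ~~ free X.
  apply/negP; rewrite /free size_tuple => /eqP XD.
  have := dimvS (subvf <<X>>%VS); rewrite XD dimvf.
  have -> : dim (V * K^o)%type = (\dim {:V}).+1 by rewrite dimvf /dim /= addn1.
  by rewrite leqNgt dD.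
move=> /existsNP[k] /not_implyP[k0] /existsNP[j0 /eqP kj0].
(* k transported from positions in the enumeration of D, and 0 outside D *)
pose l i := \sum_(j : 'I_#|D| | enum_val j == i) k j.
have lE j : l (enum_val j) = k j.
  rewrite /l (eq_bigl (xpred1 j)) ?big_pred1_eq // => j'.
  by rewrite (inj_eq enum_val_inj).
have sumE : \sum_i l i *: y i = 0.
  rewrite -[RHS]k0 (partition_big (@enum_val I D) predT) //=.
  apply: eq_bigr => i _; rewrite scaler_suml; apply: eq_bigr => j /eqP <-.
  by rewrite (nth_map j) ?size_enum_ord // nth_ord_enum.
exists l; split.
- move=> i iD; rewrite /l big_pred0 // => j; apply/negbTE/eqP => ji.
  by move: iD; rewrite -ji enum_valP.
- by exists (enum_val j0); rewrite lE.
- move: sumE => /(congr1 snd); rewrite raddf_sum => l0.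
  rewrite -[RHS]l0; apply: eq_bigr => i _ /=; exact/esym/mulr1.
- by move: sumE => /(congr1 fst); rewrite raddf_sum.
Qed.

(** While the support is too large for the dimension, subtracting a multiple
    [t] of an affine dependence [l] from the weights changes neither their sum
    nor the point they represent.  Taking for [t] the smallest ratio
    [w i / l i] over [l i > 0] keeps all weights nonnegative and annihilates
    the one that realizes the minimum. *)
Lemma caratheodory (R : realType) (V : vectType R) (A : set V) (n : nat) :
  convex_combs A n `<=` convex_combs A (\dim {:V}).+1.
Proof.
move=> p [I [w [x [w0 Ax w1 wn pE]]]].
elim: n w w0 w1 wn pE => [|n IHn] w w0 w1 wn pE.
  by exists I, w, x; split=> //; rewrite (leq_trans wn).
have [le_wd|lt_dw] := leqP #|support w| (\dim {:V}).+1.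
  by exists I, w, x.
have [l [lD [i1 li1] l0 lx0]] := affine_dependence x lt_dw.
have lw i : w i = 0 -> l i = 0.
  by move=> wi; apply: lD; rewrite inE wi eqxx.
(* l is nonzero with sum zero, so it cannot be nonpositive everywhere. *)
have [i2 li2] : exists i, 0 < l i.
  apply/not_existsP => lneg; move: li1; suff -> : l i1 = 0 by rewrite eqxx.
  have lle i : 0 <= - l i by rewrite oppr_ge0 leNgt; apply/negP/lneg.
  have /eqP : \sum_i - l i = 0 by rewrite sumrN l0 oppr0.
  rewrite psumr_eq0 // => /allP /(_ i1); rewrite mem_index_enum => /(_ isT).
  by rewrite oppr_eq0 => /eqP.
case: (@arg_minP _ _ _ _ (fun i => 0 < l i) (fun i => w i / l i) li2) =>
  i0 li0 tmin.
pose t := w i0 / l i0.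
have t0 : 0 <= t by rewrite divr_ge0 // ltW.
apply: (IHn (fun i => w i - t * l i)).
- move=> i; rewrite subr_ge0; have [li|li] := ltP 0 (l i).
    by rewrite -ler_pdivlMr //; exact: tmin.
  by rewrite (le_trans _ (w0 i)) // mulr_ge0_le0.
- by rewrite sumrB -mulr_sumr l0 mulr0 subr0.
- rewrite -ltnS (leq_trans _ wn) //; apply: proper_card.
  apply/fintype.properP; split.
    apply/fintype.subsetP => i; rewrite !inE; apply: contra => /eqP wi.
    by rewrite wi (lw _ wi) mulr0 subr0.
  exists i0; rewrite !inE.
    by apply/eqP => /lw li; rewrite li ltxx in li0.
  by rewrite negbK /t divfK ?subrr // gt_eqF.
- rewrite pE -[LHS]subr0 -[X in _ - X](scaler0 _ t) -[X in _ - t *: X]lx0.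
  rewrite scaler_sumr -sumrB; apply: eq_bigr => i _.
  by rewrite scalerA scalerBl.
Qed.

(** * Convex hulls of compact sets *)

(** The combinations of [n.+1] points of [A], built by adjoining one point at a
    time. This presentation is the one that shows compactness: the step is the
    image of a product under a continuous map. *)
Fixpoint iter_join (R : realType) (V : lmodType R) (A : set V) (n : nat) :
    set V :=
  if n is m.+1 then
    [set z.1.1 *: z.1.2 + (1 - z.1.1) *: z.2 |
      z in `[0, 1]%classic `*` A `*` iter_join A m]
  else A.

Lemma iter_join_sub_conv_hull (R : realType) (V : lmodType R) (A : set V) n :
  iter_join A n `<=` conv_hull A.
Proof.
elim: n => [|n IHn] /=; first exact: sub_conv_hull.
move=> p [[[t a] b] [/= [t01 Aa] bn] <-].
move: t01; rewrite /= in_itv /= => /andP[t0 t1].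
have /convex_setP := conv_hull_convex (A := A).
by apply=> //; [exact: sub_conv_hull|exact: IHn].
Qed.

Lemma sub_iter_join (R : realType) (V : lmodType R) (A : set V) n :
  A `<=` iter_join A n.
Proof.
elim: n => [|n IHn] // a Aa; exists (0, a, a).
  by split=> /=; [split=> //; rewrite in_itv /= lexx ler01|exact: IHn].
by rewrite /= scale0r add0r subr0 scale1r.
Qed.

(** A point of nonzero weight [w i] is split off, and the other weights are
    rescaled by [1 - w i]; the remaining combination has a smaller support. *)
Lemma convex_combs_sub_iter_join (R : realType) (V : lmodType R) (A : set V) n :
  convex_combs A n.+1 `<=` iter_join A n.
Proof.
move=> p [I [w [x [w0 Ax w1 wn pE]]]].
elim: n w w0 p w1 wn pE => [|n IHn] w w0 p w1 wn ->.
all: have [i wi] : exists i, w i != 0.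
1,3: apply/not_existsP => wz; move/eqP: w1;
  rewrite big1 1?eq_sym ?oner_eq0 // => i _; exact/eqP/negPn/negP/wz.
all: have w1i : \sum_(j | j != i) w j = 1 - w i
  by rewrite -w1 [X in X - _](bigD1 i) //= addrAC subrr add0r.
- have wz j : j != i -> w j = 0.
    move=> ji; apply/eqP; apply: contraLR wn => wj; rewrite -ltnNge.
    apply: (@leq_trans #|pred2 i j|); first by rewrite card2 eq_sym ji.
    by apply/subset_leq_card/fintype.subsetP => k; rewrite !inE => /orP[]/eqP->.
  rewrite (bigD1 i) //= big1 ?addr0 => [|j /wz ->]; last by rewrite scale0r.
  have -> : w i = 1 by apply/esym/subr0_eq; rewrite -w1i big1.
  by rewrite scale1r.
- have wi1 : w i <= 1 by rewrite -subr_ge0 -w1i sumr_ge0.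
  have [wi1'|nwi1] := eqVneq (w i) 1.
    (* Rescaling would divide by zero, but all other weights vanish. *)
    have : \sum_(j | j != i) w j == 0 by rewrite w1i wi1' subrr.
    rewrite psumr_eq0 // => /allP wz.
    rewrite (bigD1 i) //= big1 ?addr0 ?wi1' ?scale1r => [|j ji].
      exact: (@sub_iter_join _ _ _ n.+1 _ (Ax i)).
    have := wz j; rewrite mem_index_enum ji => /(_ isT) /eqP ->.
    by rewrite scale0r.
  have d0 : 0 < 1 - w i by rewrite subr_gt0 lt_neqAle nwi1.
  pose u j := if j == i then 0 else w j / (1 - w i).
  have uE j : j != i -> u j = w j / (1 - w i) by rewrite /u => /negbTE ->.
  exists (w i, x i, \sum_j u j *: x j) => /=; last first.
    rewrite [RHS](bigD1 i) //= [in LHS](bigD1 i) //= {1}/u eqxx scale0r add0r.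
    rewrite scaler_sumr; congr (_ + _); apply: eq_bigr => j ji.
    by rewrite scalerA uE // mulrC divfK // gt_eqF.
  split=> /=; first by split=> //; rewrite in_itv /= w0 wi1.
  apply: (IHn u) => //.
  + by move=> j; rewrite /u; case: eqP => // _; rewrite divr_ge0 // ltW.
  + rewrite (bigD1 i) //= {1}/u eqxx add0r (eq_bigr _ uE) -mulr_suml w1i.
    by rewrite divff // gt_eqF.
  + rewrite -ltnS (leq_trans _ wn) //; apply: proper_card.
    apply/fintype.properP; split.
      apply/fintype.subsetP => j; rewrite !inE; apply: contra => /eqP wj.
      by rewrite /u wj mul0r; case: ifP.
    by exists i; rewrite !inE // /u eqxx negbK.
Qed.

Lemma iter_join_compact (R : realType) (V : normedModType R) (A : set V) n :
  compact A -> compact (iter_join A n).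
Proof.
move=> cA; elim: n => [//|n IHn] /=.
apply: continuous_compact; last first.
  by do 2?apply: compact_setX => //; exact: segment_compact.
apply: continuous_subspaceT => z.
have c1 : z'.1 @[z' --> z] --> z.1 by exact: cvg_fst.
have cb : z'.2 @[z' --> z] --> z.2 by exact: cvg_snd.
have ct : z'.1.1 @[z' --> z] --> z.1.1.
  by apply: (@cvg_comp _ _ _ fst fst _ (nbhs z.1)) => //; exact: cvg_fst.
have ca : z'.1.2 @[z' --> z] --> z.1.2.
  by apply: (@cvg_comp _ _ _ fst snd _ (nbhs z.1)) => //; exact: cvg_snd.
by apply: cvgD; apply: cvgZ => //; apply: cvgB => //; exact: cvg_cst.
Qed.

Lemma compact_conv_hull_closed (R : realType) (A : set (R * R * R)) :
  compact A -> closed (conv_hull A).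
Proof.
(* R^o carries the vector space structure over R that gives the dimension. *)
move=> cA; set d := \dim {: (R^o * R^o * R^o)%type}.
suff -> : conv_hull A = iter_join A d.
  by apply: compact_closed; [exact: norm_hausdorff|exact: iter_join_compact].
apply/seteqP; split=> p; last exact: iter_join_sub_conv_hull.
move=> /conv_hull_sub_convex_combs[n /(@caratheodory _ (R^o * R^o * R^o)%type)].
exact: convex_combs_sub_iter_join.
Qed.

(** * The lift to 3-space *)

Lemma Gamma_J_continuous (R : realType) : continuous (@Gamma_J R).
Proof.
move=> p; have c1 : q.1 @[q --> p] --> p.1 by exact: cvg_fst.
have c2 : q.2 @[q --> p] --> p.2 by exact: cvg_snd.
have c3 : 2 * q.1 * q.2 @[q --> p] --> 2 * p.1 * p.2.
  by apply: cvgM => //; exact: cvgMr.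
exact: (@cvg_pair _ _ _ (nbhs p) (nbhs (p.1, p.2)) (nbhs (2 * p.1 * p.2)) _ _ _
  (fun q => (q.1, q.2)) _ (@cvg_pair _ _ _ _ _ _ _ _ _ _ _ c1 c2) c3).
Qed.

Lemma region_Gamma_J (R : realType) (a b c d : R) (p : R * R) :
  region a b c d p <-> 0 <= a + dot (b, c, d) (Gamma_J p).
Proof.
rewrite /region /dot /Gamma_J /=.
by have -> : a + (b * p.1 + c * p.2 + d * (2 * p.1 * p.2)) =
  a + b * p.1 + c * p.2 + 2 * d * p.1 * p.2 by ring.
Qed.

Theorem proposition9p6 (R : realType) (S : set (R * R)) :
  [/\ closed_scalar_hull S =
        \bigcap_(H in [set H : set (R * R) |
          (exists a b c d : R, H = region a b c d) /\ S `<=` H]) H,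
      closed (conv_hull (@Gamma_J R @` S)) ->
        closed_scalar_hull S = scalar_hull S &
      compact S -> closed (conv_hull (@Gamma_J R @` S))].
Proof.
split.
- apply/seteqP; split=> p.
    move=> hp _ [[a [b [c [d ->]]]] SH]; apply/region_Gamma_J.
    have hull_half : closed_conv_hull (@Gamma_J R @` S) `<=`
        [set z | 0 <= a + dot (b, c, d) z].
      rewrite /closed_conv_hull closureE.
      apply: smallest_sub; first exact: halfspace_closed.
      apply: smallest_sub; first exact: halfspace_convex.
      by move=> _ [q Sq <-]; apply/region_Gamma_J; exact: SH.
    exact: (hull_half _ hp).
  move=> hp; apply: contrapT => np.
  have [|a [[[b c] d] [hull_half]]] := separation _ (@closed_closure _ _) np.
    by apply: closure_convex; exact: conv_hull_convex.
  apply/negP; rewrite -leNgt; apply/region_Gamma_J; apply: hp.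
  split; first by exists a, b, c, d.
  move=> q Sq; apply/region_Gamma_J; apply: hull_half.
  by apply: subset_closure; apply: sub_conv_hull; exists q.
- by move=> /closure_id hE; rewrite /closed_scalar_hull /closed_conv_hull -hE.
- move=> cS; apply: compact_conv_hull_closed; apply: continuous_compact => //.
  by apply: continuous_subspaceT; exact: Gamma_J_continuous.
Qed.
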